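(* Let $n\ge1$ and let $\mathcal{BC}_n$ be the arrangement in $\mathbb{R}^n$ with hyperplanes $$x_i=-\tfrac32,-1,-\tfrac12,0,\tfrac12\ (1\le i\le n),\qquad x_i+x_j=-2,-1,0,\qquad x_i-x_j=-1,0,1\ (1\le i<j\le n).$$ The number of type $BC$ sketches, which is the number of regions of $\mathcal{BC}_n$, is $$2^{n-1}\,n!\binom{2n+2}{n+1}.$$
   Context: A region of an arrangement is a connected component of the complement of the union of its hyperplanes. $[n]=\{1,\dots,n\}$. $\mathcal{BC}_n$ is the translate (by $X_i=x_i+\tfrac12$) of the type $BC$ Catalan arrangement $X_i=-1,0,1$; $2X_i=-1,0,1$; $X_i\pm X_j=-1,0,1$. Let $B(n)$ be the set of $4n+4$ letters $\alpha_i^{(s)}$ and $\alpha_{-i}^{(-s)}$ ($i\in[n]$, $s\in\{0,1\}$) together with $\alpha_-^{(-1.5)},\alpha_-^{(-0.5)},\alpha_+^{(0.5)},\alpha_+^{(1.5)}$. Here $\alpha_i^{(s)}$ represents $x_i+s$, $\alpha_{-i}^{(-s)}$ represents $-x_i-s$, and the last four letters represent the numbers $-\tfrac32,-\tfrac12,\tfrac12,\tfrac32$ respectively. A pointed symmetric sketch is a total order on $B(n)$ (written as a word) for which there is a point $(x_1,\dots,x_n)\in\mathbb{R}^n$ such that the represented real numbers are strictly increasing along the word. To a pointed symmetric sketch one associates its pointed $\alpha,\beta$-word, of length $2n+2$: for each of the first $2n+2$ letters of the sketch (its first half), write $\alpha$ if the letter is of the form $\alpha_i^{(0)}$, $\alpha_{-i}^{(-1)}$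 ($i\in[n]$) or $\alpha_-^{(-1.5)}$, and write $\beta$ otherwise; the $\beta$ coming from $\alpha_-^{(-0.5)}$ is marked (''pointed to''). A type $BC$ sketch is a pointed symmetric sketch such that the letter immediately after the $(n+1)$-th $\alpha$ in its pointed $\alpha,\beta$-word is the pointed $\beta$. *)

(* Defs.v *)
From HB Require Import structures.
From mathcomp Require Import all_boot all_order all_algebra.
From mathcomp Require Import all_classical all_reals all_analysis.
Set Implicit Arguments.
Unset Strict Implicit.
Unset Printing Implicit Defensive.
Import Order.TTheory GRing.Theory Num.Theory.
Import numFieldNormedType.Exports.
Local Open Scope classical_set_scope.
Local Open Scope ring_scope.

Definition regions (T : topologicalType) (A : set (set T)) : set (set T) :=
  [set C | exists2 x, (~` \bigcup_(H in A) H) x &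
                      C = connected_component (~` \bigcup_(H in A) H) x].

Definition arrangement_BC (R : realType) (n : nat) : set (set 'rV[R]_n) :=
  [set H |
     (exists (i : 'I_n) (c : R),
        c \in [:: - (3 / 2); - 1; - (1 / 2); 0; 1 / 2] /\
        H = [set x : 'rV[R]_n | x 0 i = c])
  \/ (exists (i j : 'I_n) (c : R),
        [/\ (i < j)%N, c \in [:: - 2; - 1; 0] &
            H = [set x : 'rV[R]_n | x 0 i + x 0 j = c]])
  \/ (exists (i j : 'I_n) (c : R),
        [/\ (i < j)%N, c \in [:: - 1; 0; 1] &
            H = [set x : 'rV[R]_n | x 0 i - x 0 j = c]])].

Arguments arrangement_BC R n : clear implicits.

(* [alpha_pos i s] is alpha_i^(s) and [alpha_neg i s] is alpha_{-i}^(-s), where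
   the boolean s stands for 0 or 1; [alpha_m15], [alpha_m05], [alpha_p05] and
   [alpha_p15] are alpha_-^(-1.5), alpha_-^(-0.5), alpha_+^(0.5) and
   alpha_+^(1.5). *)
Inductive letter (n : nat) : Type :=
| alpha_pos of 'I_n & bool
| alpha_neg of 'I_n & bool
| alpha_m15
| alpha_m05
| alpha_p05
| alpha_p15.

Arguments alpha_m15 {n}.
Arguments alpha_m05 {n}.
Arguments alpha_p05 {n}.
Arguments alpha_p15 {n}.

Definition letter_code (n : nat) (l : letter n) :
    ('I_n * bool) + ('I_n * bool) + (bool * bool) :=
  match l with
  | alpha_pos i s => inl (inl (i, s))
  | alpha_neg i s => inl (inr (i, s))
  | alpha_m15 => inr (false, false)
  | alpha_m05 => inr (false, true)
  | alpha_p05 => inr (true, false)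
  | alpha_p15 => inr (true, true)
  end.

Definition letter_decode (n : nat)
    (c : ('I_n * bool) + ('I_n * bool) + (bool * bool)) : letter n :=
  match c with
  | inl (inl (i, s)) => alpha_pos i s
  | inl (inr (i, s)) => alpha_neg i s
  | inr (false, false) => alpha_m15
  | inr (false, true) => alpha_m05
  | inr (true, false) => alpha_p05
  | inr (true, true) => alpha_p15
  end.

Lemma letter_codeK (n : nat) : cancel (@letter_code n) (@letter_decode n).
Proof. by case. Qed.

HB.instance Definition _ (n : nat) :=
  Finite.copy (letter n) (can_type (@letter_codeK n)).

Definition letter_value (R : realType) (n : nat) (x : 'rV[R]_n)
    (l : letter n) : R :=
  match l with
  | alpha_pos i s => x 0 i + s%:R
  | alpha_neg i s => - x 0 i - s%:R
  | alpha_m15 => - (3 / 2)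
  | alpha_m05 => - (1 / 2)
  | alpha_p05 => 1 / 2
  | alpha_p15 => 3 / 2
  end.

Definition pointed_symmetric_sketch (R : realType) (n : nat)
    (w : seq (letter n)) : Prop :=
  perm_eq w (enum {: letter n}) /\
  exists x : 'rV[R]_n, sorted <%R [seq letter_value x l | l <- w].

Inductive ab_letter : Type := ab_alpha | ab_beta | ab_pointed_beta.

Definition is_ab_alpha (a : ab_letter) : bool :=
  if a is ab_alpha then true else false.

Definition ab_of_letter (n : nat) (l : letter n) : ab_letter :=
  match l with
  | alpha_pos _ false | alpha_neg _ true | alpha_m15 => ab_alpha
  | alpha_m05 => ab_pointed_beta
  | _ => ab_beta
  end.

Definition pointed_ab_word (n : nat) (w : seq (letter n)) : seq ab_letter :=
  [seq ab_of_letter l | l <- take (2 * n + 2) w].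

(* As [u] contains [n] alphas, the alpha displayed after [u] is the (n+1)-th. *)
Definition type_BC_sketch (R : realType) (n : nat)
    (w : seq (letter n)) : Prop :=
  pointed_symmetric_sketch R w /\
  exists u v : seq ab_letter,
    pointed_ab_word w = u ++ [:: ab_alpha, ab_pointed_beta & v] /\
    count is_ab_alpha u = n.

Arguments type_BC_sketch R {n} w.

(* Main.v *)
Require Import Defs.
From mathcomp Require Import all_boot all_order all_algebra.
From mathcomp Require Import all_classical all_reals all_analysis.
From mathcomp Require Import zify ring lra.
Import Order.TTheory GRing.Theory Num.Theory.
Import numFieldNormedType.Exports.

(** Put [X_i = x_i + 1/2].  A point [Y] of the real line carries an alpha at
    [Y - 1/2] and a beta at [Y + 1/2].  The hyperplanes of BC_n are exactly the
    coincidences between the letters of the points [±X_i] and [0], so a region is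
    an order of these letters; a pointed symmetric sketch is an order of the
    letters of [±X_i] and [±1].  In both cases [Y -> -Y] reverses the order and
    exchanges alpha and beta, so the order is determined by the signs of the
    [X_i], the order of the [|X_i|] and the alpha-beta word of the negative
    letters, a ballot word.

    For regions this word has length [2n+1] and every ballot word occurs.  For
    type BC sketches the pointed beta comes immediately after the (n+1)-th
    alpha; erasing it gives again an arbitrary ballot word of length [2n+1].
    There are ['C(2n+1, n)] such words, and [2 ^ n * n`!] signed orders.

    A ballot word [alpha^k beta r] is realized by realizing [alpha^(k-1) r] and
    inserting the missing beta, at some value [c], in the gap where it belongs:
    its alpha, at [c - 1], then precedes every other letter.  Thus the betas are
    inserted one by one, the last one first.  When the pointed beta is to be
    inserted, the gap contains the alpha of the point [0], at [-1/2], which is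
    replaced by the beta of the point [-1]. *)

Set Implicit Arguments.
Unset Strict Implicit.
Unset Printing Implicit Defensive.

(** * Ballot words *)

(* [true] stands for beta and [false] for alpha; [h] is the current excess of
   alphas over betas. *)
Fixpoint ballot (h : nat) (p : seq bool) : bool :=
  if p is b :: p' then
    if b then (0 < h) && ballot h.-1 p' else ballot h.+1 p'
  else true.

Lemma ballotP h p :
  reflect (forall k, count id (take k p) <= h + count negb (take k p))
          (ballot h p).
Proof.
elim: p h => [|[] p IH] h /=; first by apply: ReflectT.
- apply: (iffP andP) => [[h0 /IH H] [|k] //=|H].
    by have := H k; lia.
  have h0 : 0 < h by have := H 1; rewrite /= take0 /=; lia.
  by split=> //; apply/IH => k; have := H k.+1; rewrite /=; lia.
- apply: (iffP (IH _)) => [H [|k] //=|H k].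
    by have := H k; lia.
  by have := H k.+1; rewrite /=; lia.
Qed.

Lemma ballot_cat h p q :
  ballot h (p ++ q) = ballot h p && ballot (h + count negb p - count id p) q.
Proof.
elim: p h => [|[] p IH] h /=; first by rewrite addn0 subn0.
- rewrite IH; case: h => //= h; congr (_ && ballot _ _); lia.
- rewrite IH; congr (_ && ballot _ _); lia.
Qed.

Lemma ballot_short h p : size p <= h -> ballot h p.
Proof. by elim: p h => [|[] p IH] [|h] //= le; apply: IH; lia. Qed.

Lemma ballot_count h p : ballot h p -> count id p <= h + count negb p.
Proof. by move/ballotP/(_ (size p)); rewrite take_size. Qed.

Lemma count_negb_id (p : seq bool) : count id p + count negb p = size p.
Proof. exact: count_predC. Qed.

Lemma first_true (p : seq bool) :
  p = nseq (size p) false \/ exists a r, p = nseq a false ++ true :: r.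
Proof.
elim: p => [|[] p [IH|[a [r IH]]]]; [by left| | | |].
- by right; exists 0, p.
- by right; exists 0, p.
- by left; rewrite /= -IH.
- by right; exists a.+1, r; rewrite IH.
Qed.

(** The first beta cancels one of the alphas before it, so [r] is read from the same excess once
    both are erased. Inserting a pair of opposite points undoes this erasure. *)
Lemma ballot_drop_first a r :
  ballot 0 (nseq a false ++ true :: r) ->
  exists2 b, a = b.+1 & ballot 0 (nseq b false ++ r).
Proof.
rewrite ballot_cat /= !count_nseq /= mul0n mul1n subn0 add0n.
case: a => [|a] /=; first by [].
move=> /andP[_ br]; exists a => //.
rewrite ballot_cat !count_nseq /= mul0n mul1n subn0 add0n br andbT.
by elim: a 0 {br} => //= a IH h; apply: IH.
Qed.

Lemma split_false n (p : seq bool) : n < count negb p ->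
  exists u v, p = u ++ false :: v /\ count negb u = n.
Proof.
elim: p n => [|[] p IH] n //=.
  rewrite add0n => /IH[u [v [-> <-]]]; by exists (true :: u), v.
case: n => [|n]; first by exists [::], p.
by rewrite add1n ltnS => /IH[u [v [-> <-]]]; exists (false :: u), v.
Qed.

(** The number of alphas in the prefix fixes the rank of the displayed alpha, hence the place of the
    cut. *)
Lemma split_false_inj (u v u' v' : seq bool) :
  u ++ false :: v = u' ++ false :: v' -> count negb u = count negb u' ->
  u = u' /\ v = v'.
Proof.
elim: u u' => [|b u IH] [|b' u'] //=.
- by case=> <-.
- by case=> <-.
- by case=> -> <-.
- by case=> -> /IH{}IH /addnI/IH[-> ->].
Qed.

Lemma ballot_half n p : ballot 0 p -> size p = 2 * n + 1 -> n < count negb p.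
Proof. by move=> /ballot_count; have := count_negb_id p; lia. Qed.

(** If [u] has [b] betas, then [v] has length [n - b], and without the marked beta it is read from
    the excess [n + 1 - b]: it is too short to violate the ballot condition. *)
Lemma unmark_ballot n u v : size (u ++ [:: false, true & v]) = 2 * n + 2 ->
  count negb u = n -> ballot 0 (u ++ [:: false, true & v]) ->
  size (u ++ false :: v) = 2 * n + 1 /\ ballot 0 (u ++ false :: v).
Proof.
rewrite !size_cat !ballot_cat /= => sp cu /andP[-> _]; have := count_negb_id u.
by split; [lia | apply: ballot_short; lia].
Qed.

Definition nballot L h := #|[set t : L.-tuple bool | ballot h t]|.

Lemma nballotS L h :
  nballot L.+1 h = nballot L h.+1 + (0 < h) * nballot L h.-1.
Proof.
rewrite /nballot -!sum1dep_card.
rewrite (reindex (fun x : bool * L.-tuple bool => [tuple of x.1 :: x.2])) /=; last first.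
  exists (fun t => (thead t, [tuple of behead t])) => [[b t] _|t _] /=.
    by congr pair; apply: val_inj.
  by rewrite [in RHS](tuple_eta t).
rewrite -(pair_big_dep xpredT (fun (b : bool) (t : L.-tuple bool) =>
  if b then (0 < h) && ballot h.-1 t else ballot h.+1 t) (fun _ _ => 1)) /=.
rewrite big_bool /= addnC; congr addn.
by case: (0 < h) => /=; rewrite ?mul1n ?mul0n // big_pred0.
Qed.

Lemma sum_binS L k :
  \sum_(d < k) 'C(L.+1, d) = \sum_(d < k) 'C(L, d) + \sum_(d < k.-1) 'C(L, d).
Proof.
case: k => [|k]; first by rewrite !big_ord0.
rewrite !big_ord_recl /= !bin0 -addnA; congr addn.
by rewrite -big_split /=; apply: eq_bigr => i _; rewrite binS.
Qed.

(* Reflection principle: with [D] the largest admissible number of betas, the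
   ballot words are counted by the sum of ['C(L, d)] over [D - h <= d <= D]. *)
Lemma nballot_sum L h :
  nballot L h + \sum_(d < (L + h)./2 - h) 'C(L, d)
    = \sum_(d < (L + h)./2.+1) 'C(L, d).
Proof.
elim: L h => [|L IH] h.
  rewrite /nballot -sum1dep_card (big_pred1 [tuple]) => [|t]; last by rewrite tuple0.
  have -> : h./2 - h = 0 by lia.
  rewrite big_ord0 add0n addn0 big_ord_recl big1 //.
rewrite nballotS !sum_binS.
have := IH h.+1; have -> : (L + h.+1)./2 = (L.+1 + h)./2 by congr half; lia.
rewrite subnS; set D := (L.+1 + h)./2 => <-.
case: h @D => [|h] D /=.
  by rewrite mul0n subn0; lia.
have := IH h; have E : D = (L + h)./2.+1 by rewrite /D; lia.
by rewrite mul1n E subSS /= => <-; lia.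
Qed.

(** For [h = 0] the two sums of [nballot_sum] differ only by the term of index [n]. *)
Lemma nballot_odd n : nballot (2 * n + 1) 0 = 'C(2 * n + 1, n).
Proof.
have := nballot_sum (2 * n + 1) 0.
have -> : (2 * n + 1 + 0)./2 = n by lia.
by rewrite subn0 big_ord_recr /= addnC => /addnI.
Qed.

Local Open Scope ring_scope.

(** * Realization of ballot words *)

Section Realization.
Variable R : realFieldType.
Implicit Types (Y Z : seq R) (D : seq (R * bool)).

(* Letters at [0] are kept: as [realizes] requires negative values, it excludes
   them. *)
Definition half_letters Y : seq (R * bool) :=
  [seq a <- flatten [seq [:: (y - 1 / 2, false); (y + 1 / 2, true)] | y <- Y]
     | a.1 <= 0].

(** Strict sorting forbids coincidences between the nonpositive letters, so a realization also
    carries genericity. *)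
Definition realizes Y D : Prop :=
  [/\ sorted <%R (map fst D), all (fun a => a.1 < 0) D &
      perm_eq D (half_letters Y)].

Definition sym_points Z : seq R := flatten [seq [:: - z; z] | z <- Z].

Lemma mem_half_letters Y a :
  (a \in half_letters Y) =
  [&& a.1 <= 0 & (if a.2 then a.1 - 1 / 2 else a.1 + 1 / 2) \in Y].
Proof.
rewrite mem_filter; congr (_ && _).
apply/flatten_mapP/idP => [[y yY]|].
  by rewrite !inE => /orP[] /eqP-> /=; rewrite ?subrK ?addrK.
by case: a => v [] /= vY; eexists; try exact: vY; rewrite !inE ?subrK ?addrK eqxx ?orbT.
Qed.

Lemma perm_half_letters Y Y' :
  perm_eq Y Y' -> perm_eq (half_letters Y) (half_letters Y').
Proof. by move=> YY'; apply/perm_filter/perm_flatten/perm_map. Qed.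

Lemma exists_gap (s1 s2 : seq R) :
  {in s1 & s2, forall a b, a < b} ->
  exists c, all (fun a => a < c) s1 && all (fun b => c < b) s2.
Proof.
(* The case of a single lower bound. The elements of [s1] are then treated one by one, keeping the
   maximum of the values found. *)
have above a (s : seq R) : all (fun b => a < b) s ->
    exists2 c, a < c & all (fun b => c < b) s.
  elim: s => [_|b s IH /= /andP[ab /IH[c ac cs]]].
    by exists (a + 1) => //; lra.
  exists (Num.min c ((a + b) / 2)).
    by rewrite lt_min ac /=; lra.
  rewrite gt_min; apply/andP; split; first by apply/orP; right; lra.
  by apply: sub_all cs => d cd; rewrite gt_min cd.
elim: s1 => [_|a s1 IH lts].
  elim: s2 => [|b s2 [c /= cs]]; first by exists 0.
  exists (Num.min c (b - 1)) => /=; rewrite gt_min.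
  apply/andP; split; first by apply/orP; right; lra.
  by apply: sub_all cs => d cd; rewrite gt_min cd.
have [|c /andP[sc cs]] := IH.
  by move=> x y xs; apply: lts; rewrite inE xs orbT.
have [d ad ds] : exists2 c, a < c & all (fun b => c < b) s2.
  by apply: above; apply/allP => b; apply: lts; rewrite mem_head.
exists (Num.max c d) => /=; rewrite lt_max ad orbT /=; apply/andP; split.
  by apply: sub_all sc => x xc; rewrite lt_max xc.
by apply/allP => x xs; rewrite gt_max (allP cs) ?(allP ds).
Qed.

(* The new point [c - 1/2] is the leftmost one: each alpha of [D1] either has
   its beta in [D2], or its beta is positive. *)
Lemma realizes_insert Y D1 D2 c :
  realizes Y (D1 ++ D2) -> all (fun a => ~~ a.2) D1 ->
  all (fun a => a.1 < c) D1 -> all (fun a => c < a.1) D2 -> c < 0 ->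
  realizes [:: c - 1 / 2, 1 / 2 - c & Y]
    ((c - 1, false) :: D1 ++ (c, true) :: D2).
Proof.
move=> [sD nD pD] aD1 D1c cD2 c0; split; first last.
- rewrite /half_letters /=.
  have -> : c - 1 / 2 - 1 / 2 = c - 1 by lra.
  have -> : 1 / 2 - c - 1 / 2 = - c by lra.
  have -> : c - 1 <= 0 by lra.
  rewrite subrK (ltW c0) !lt_geF; try lra.
  by rewrite perm_cons -cat1s perm_catCA /= perm_cons.
- move: nD; rewrite /= !all_cat /= c0 => /andP[-> ->]; rewrite !andbT; lra.
move: sD; rewrite !(sorted_pairwise lt_trans) /= !map_cat !pairwise_cat /=.
case/and3P => D12 pD1 pD2.
rewrite all_cat /= allrel_consr D12 pD1 pD2 !andbT !all_map /=.
rewrite D1c cD2 !andbT; apply/and3P; split; last 1 first.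
- by apply: sub_all cD2 => a /=; lra.
- apply/allP => -[v b] aD /=.
  have /= nb := allP aD1 _ aD; have vc := allP D1c _ aD.
  case: b nb aD vc => //= _ aD vc.
  have : (v, false) \in half_letters Y by rewrite -(perm_mem pD) mem_cat aD.
  rewrite mem_half_letters /= => /andP[_ vY].
  have [v0|v0] := lerP (v + 1) 0; last lra.
  have : (v + 1, true) \in D1 ++ D2.
    by rewrite (perm_mem pD) mem_half_letters /= v0; congr (_ \in Y): vY; lra.
  rewrite mem_cat => /orP[/(allP aD1) //|/(allP cD2)] /=; lra.
- lra.
Qed.

Lemma realizes_insert_ex Y D1 D2 :
  realizes Y (D1 ++ D2) -> all (fun a => ~~ a.2) D1 ->
  exists2 c, c < 0 & realizes [:: c - 1 / 2, 1 / 2 - c & Y]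
    ((c - 1, false) :: D1 ++ (c, true) :: D2).
Proof.
move=> rD aD1; case: (rD) => sD nD _.
(* With [0] among the upper bounds [c] is negative: its beta is kept, while the alpha of the
   opposite point, at [- c], is positive and is not. *)
have [|c /andP[D1c /= /andP[c0 cD2]]] := @exists_gap (map fst D1) (0 :: map fst D2).
  move=> _ b /mapP[a aD ->]; rewrite inE => /orP[/eqP->|bD2].
    by apply: (allP nD); rewrite mem_cat aD.
  move: sD; rewrite (sorted_pairwise lt_trans) map_cat pairwise_cat.
  by move=> /and3P[/allrelP H _ _]; apply: H => //; apply: map_f.
exists c => //; apply: realizes_insert => //.
  by rewrite all_map in D1c.
by rewrite all_map in cD2.
Qed.

(** All points are kept below [1 / 2] in absolute value: their alphas are then negative and their
    betas positive. *)
Lemma realize_alphas h : exists Z D,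
  [/\ size Z = h, all (fun z => 0 < z) Z, realizes (sym_points Z ++ [:: 0]) D &
      map snd D = nseq (2 * h + 1) false].
Proof.
(* The bound [b] on the absolute values of the points, expressed on their alphas, leaves room for a
   farther pair. *)
suff [Z [D [b [_ H]]]] : exists Z D b,
    (0 <= b < 1 / 2 /\ all (fun a => - b - 1 / 2 <= a.1 <= b - 1 / 2) D) /\
    [/\ size Z = h, all (fun z => 0 < z) Z, realizes (sym_points Z ++ [:: 0]) D &
      map snd D = nseq (2 * h + 1) false] by exists Z, D.
elim: h => [|h [Z [D [b [[/andP[b0 b1] DB] [sZ pZ [sD nD pD] aD]]]]]].
  exists [::], [:: (- (1 / 2), false)], 0; split.
    by split; [lra | rewrite /= andbT; lra].
  split=> //; split=> //=; first by rewrite andbT; lra.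
  rewrite /half_letters /= sub0r add0r.
  have -> : - (1 / 2) <= 0 :> R by lra.
  by rewrite lt_geF //; lra.
(* Halfway between [b] and [1 / 2]: the alphas of [- z] and [z] enclose the old ones, and both betas
   stay positive. *)
pose z := (b + 1 / 2) / 2.
exists (z :: Z), ((- z - 1 / 2, false) :: rcons D (z - 1 / 2, false)), z.
have bz : b < z by rewrite /z; lra.
have z1 : z < 1 / 2 by rewrite /z; lra.
split; split; first lra; last 1 first.
- have -> : (2 * h.+1 + 1 = 1 + (2 * h + 1 + 1))%N by lia.
  rewrite -[RHS]/(false :: nseq (2 * h + 1 + 1) false) nseqD.
  by rewrite map_cons map_rcons aD -cats1.
- rewrite /= all_rcons /=; apply/and3P; split; [lra|lra|].
  by apply: sub_all DB => a /andP[? ?]; apply/andP; split; lra.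
- by rewrite /= sZ.
- by rewrite /= pZ andbT; lra.
split; first last.
- rewrite /half_letters /=.
  have -> : - z - 1 / 2 <= 0 by lra.
  have -> : z - 1 / 2 <= 0 by lra.
  rewrite !lt_geF; try lra.
  by rewrite perm_cons -cats1 perm_catC /= perm_cons.
- rewrite /= all_rcons nD /= andbT; apply/andP; split; lra.
move: sD; rewrite !(sorted_pairwise lt_trans) /= map_rcons all_rcons /=.
rewrite -cats1 pairwise_cat /= => ->; rewrite !andbT /=.
rewrite allrel1r !all_map /= -andbA; apply/and3P; split; first lra.
  by apply: sub_all DB => a /= /andP[? ?]; lra.
by apply: sub_all DB => a /= /andP[? ?]; lra.
Qed.

Lemma realize_region h p : size p = (2 * h + 1)%N -> ballot 0 p ->
  exists Z D, [/\ size Z = h, all (fun z => 0 < z) Z,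
    realizes (sym_points Z ++ [:: 0]) D & map snd D = p].
Proof.
elim: h p => [|h IH] p sp bp; have [->|[a [r Ep]]] := first_true p.
- by rewrite sp; apply: realize_alphas.
(* For [h = 0] the only letter cannot be a beta, which needs an alpha before it. *)
- by move: bp sp; rewrite Ep => /ballot_drop_first[b -> _]; rewrite size_cat /=; lia.
- by rewrite sp; apply: realize_alphas.
move: bp sp; rewrite Ep => /ballot_drop_first[b -> bp] sp.
have [|Z [D [sZ pZ rD aD]]] := IH _ _ bp.
  by move: sp; rewrite !size_cat /= !size_nseq; lia.
have Da : map snd (take b D) = nseq b false.
  by rewrite map_take aD take_size_cat ?size_nseq.
have Dr : map snd (drop b D) = r.
  by rewrite map_drop aD drop_size_cat ?size_nseq.
rewrite -(cat_take_drop b D) in rD.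
have [|c c0 rD'] := realizes_insert_ex rD.
  have : all negb (map snd (take b D)) by rewrite Da all_nseq orbT.
  by rewrite all_map.
exists ((1 / 2 - c) :: Z), ((c - 1, false) :: take b D ++ (c, true) :: drop b D).
split; rewrite /= ?sZ ?pZ //; first by rewrite andbT; lra.
  by rewrite opprB.
by rewrite map_cat /= Da Dr.
Qed.

(** The alpha of [0] sits at [- (1 / 2)], and of each pair [- z], [z] only the alpha of [- z] is to
    its left. This locates the alpha of [0] in the word. *)
Lemma count_half_letters Z : all (fun z => 0 < z) Z ->
  count (fun a => ~~ a.2 && (a.1 < - (1 / 2)))
    (half_letters (sym_points Z ++ [:: 0])) = size Z.
Proof.
rewrite /half_letters count_filter.
elim: Z => [_|z Z IH /= /andP[z0 /IH ->]] /=.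
  by rewrite (_ : (0 - 1 / 2 < - (1 / 2) :> R) = false) //; apply/negbTE; lra.
have -> : - z - 1 / 2 < - (1 / 2) by lra.
have -> : - z - 1 / 2 <= 0 by lra.
by rewrite (_ : (z - 1 / 2 < - (1 / 2)) = false) //; apply/negbTE; lra.
Qed.

(** Exactly [size Z] alphas lie left of [- (1 / 2)]. For smaller [d], the letters of [D1] and [d]
    would be one too many; for larger [d], the alpha of [0] would occupy a place in [D1] and leave
    one too few. *)
Lemma realizes_middle Z D1 D2 d : all (fun z => 0 < z) Z ->
  realizes (sym_points Z ++ [:: 0]) (D1 ++ (d, false) :: D2) ->
  all (fun a => ~~ a.2) D1 -> size D1 = size Z -> d = - (1 / 2).
Proof.
move=> pZ [sD _ pD] aD1 sD1; have := count_half_letters pZ.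
rewrite -(permP pD) count_cat /=.
move: sD; rewrite (sorted_pairwise lt_trans) map_cat pairwise_cat /=.
rewrite allrel_consr !all_map => /and3P[/andP[D1d _] _ /andP[dD2 _]].
have [dl|dg|//] := ltgtP d (- (1 / 2)).
  rewrite (_ : count _ D1 = size D1); first by rewrite sD1; lia.
  apply/eqP; rewrite -all_count; apply/allP => a aD /=.
  by rewrite (allP aD1) //=; apply: lt_trans dl; apply: (allP D1d).
have mD1 : (- (1 / 2), false) \in D1.
  have : (- (1 / 2), false) \in D1 ++ (d, false) :: D2.
    rewrite (perm_mem pD) mem_half_letters /= addNr mem_cat mem_head orbT andbT; lra.
  rewrite mem_cat inE => /or3P[//|/eqP[E]|/(allP dD2) /=].
    by move: dg; rewrite E ltxx.
  by move=> /(lt_trans dg); rewrite ltxx.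
set c := count _ _; set c2 := count _ _ => E.
have c2_0 : c2 = 0%N.
  apply/eqP; rewrite -leqn0 leqNgt -has_count; apply/hasPn => a aD.
  rewrite negb_and; apply/orP; right; rewrite -leNgt.
  exact/ltW/(lt_trans dg)/(allP dD2).
have : (c < size D1)%N.
  rewrite ltn_neqAle count_size andbT -all_count; apply/negP => /allP/(_ _ mD1).
  by rewrite /= ltxx.
by rewrite sD1 -E c2_0; lia.
Qed.

(** The given word lacks the pointed beta, which reappears at [- (1 / 2)] as the beta of [-1]. The
    betas of [u] are removed by induction; once [u] has only alphas, a realization with the point
    [0] is converted into one with [-1] and [1]. *)
Lemma realize_sketch h u v : size (u ++ false :: v) = (2 * h + 1)%N ->
  count negb u = h -> ballot 0 (u ++ false :: v) ->
  exists Z D1 D2, [/\ size Z = h, all (fun z => 0 < z) Z,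
    realizes (sym_points Z ++ [:: -1; 1]) (D1 ++ (- (1 / 2), true) :: D2),
    map snd D1 = rcons u false & map snd D2 = v].
Proof.
have [m] := ubnP h; elim: m h u => // m IH h u hm sp cu bp.
have [Eu|[a [r Eu]]] := first_true u.
  have Eh : size u = h by move: cu; rewrite Eu count_nseq mul1n size_nseq.
  rewrite Eh in Eu.
  have [Z [D [sZ pZ rD aD]]] := realize_region sp bp.
  have Du : map snd (take h D) = u by rewrite map_take aD -{1}Eh take_size_cat.
  have : map snd (drop h D) = false :: v by rewrite map_drop aD -{1}Eh drop_size_cat.
  case DE : (drop h D) => [|[d []] D2] //= [Dv].
  have rD' : realizes (sym_points Z ++ [:: 0]) (take h D ++ (d, false) :: D2).
    by rewrite -DE cat_take_drop.
  move: (take h D) Du rD' => D1 Du rD' {aD DE D rD}.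
  have aD1 : all (fun a => ~~ a.2) D1.
    have : all negb (map snd D1) by rewrite Du Eu all_nseq orbT.
    by rewrite all_map.
  have sD1 : size D1 = h by rewrite -Eh -Du size_map.
  have Ed := realizes_middle pZ rD' aD1 (etrans sD1 (esym sZ)).
  (* The alpha of [-1], put in front, makes up for the alpha of [0] lost in the middle. *)
  exists Z, ((- (3 / 2), false) :: D1), D2; split => //; last first.
    by rewrite /= Du Eu -cats1 -[[:: false]]/(nseq 1 false) -nseqD addn1.
  case: (rD') => sD nD pD; move: sD; rewrite (sorted_pairwise lt_trans).
  rewrite map_cat pairwise_cat /= allrel_consr Ed => /and3P[/andP[D1d _] _ /andP[dD2 _]].
  (* Deleting the point [0] deletes the single letter [d], since its beta is positive. *)
  have rY : realizes (sym_points Z) (D1 ++ D2).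
    split.
    - case: (rD') => + _ _; rewrite !(sorted_pairwise lt_trans) !map_cat !pairwise_cat.
      by rewrite /= allrel_consr => /and3P[/andP[_ ->] -> /andP[_ ->]].
    - by move: nD; rewrite !all_cat /= => /and3P[-> _ ->].
    - have /(perm_trans pD) : perm_eq (half_letters (sym_points Z ++ [:: 0]))
          ((d, false) :: half_letters (sym_points Z)).
        rewrite (permPl (perm_half_letters (permEl (perm_catC _ _)))) Ed /half_letters /=.
        rewrite sub0r add0r; have -> : - (1 / 2) <= 0 :> R by lra.
        by rewrite lt_geF //; lra.
      by rewrite -cat1s perm_catCA perm_cons.
  have D1c : all (fun a => a.1 < - (1 / 2)) D1 by rewrite all_map in D1d.
  have cD2 : all (fun a => - (1 / 2) < a.1) D2 by rewrite all_map in dD2.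
  have c0 : - (1 / 2) < 0 :> R by lra.
  (* Inserting at [c = - (1 / 2)] creates exactly the points [-1] and [1]. *)
  have := realizes_insert rY aD1 D1c cD2 c0.
  have -> : - (1 / 2) - 1 = - (3 / 2) :> R by lra.
  have -> : - (1 / 2) - 1 / 2 = -1 :> R by lra.
  have -> : 1 / 2 - - (1 / 2) = 1 :> R by lra.
  case=> sI nI pI; split => //; rewrite (permPl pI).
  exact: (perm_half_letters (permEl (perm_catC [:: -1; 1] _))).
have /ballot_drop_first[b Eb bp'] : ballot 0 (nseq a false ++ true :: r ++ false :: v).
  by move: bp; rewrite Eu -catA.
have {}Eu : u = false :: nseq b false ++ true :: r by rewrite Eu Eb.
case: h cu hm sp => [|h] cu hm sp; first by move: cu; rewrite Eu.
have [||||Z [D1 [D2 [sZ pZ rD D1u D2v]]]] := IH h (nseq b false ++ r).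
- by [].
- by move: sp; rewrite Eu /= !size_cat /= ?size_cat /=; lia.
- by move: cu; rewrite Eu /= !count_cat /= add1n => -[].
- by rewrite -catA.
have Da : map snd (take b D1) = nseq b false.
  by rewrite map_take D1u -cats1 -catA take_size_cat ?size_nseq.
have Dr : map snd (drop b D1) = rcons r false.
  by rewrite map_drop D1u -cats1 -catA drop_size_cat ?size_nseq // cats1.
rewrite -(cat_take_drop b D1) -catA in rD.
have [|c c0 rD'] := realizes_insert_ex rD.
  have : all negb (map snd (take b D1)) by rewrite Da all_nseq orbT.
  by rewrite all_map.
exists ((1 / 2 - c) :: Z), ((c - 1, false) :: take b D1 ++ (c, true) :: drop b D1), D2.
split; rewrite /= ?sZ ?pZ //; first by rewrite andbT; lra.
  by rewrite opprB -catA.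
by rewrite map_cat /= Da Dr Eu -!cats1 /= -catA.
Qed.
End Realization.

(** * Words of odd labellings *)

(** A shuffle of two sequences is recovered from them and from the pattern telling which one each
    letter comes from. *)
Lemma eq_from_filter (T : eqType) (P : pred T) (s t : seq T) :
  map P s = map P t -> seq.filter P s = seq.filter P t ->
  seq.filter (predC P) s = seq.filter (predC P) t -> s = t.
Proof.
elim: s t => [|a s IH] [|b t] //= [Eab Est].
rewrite Eab; case: (P b) => /= [[-> E1] E2|E1 [-> E2]]; congr cons; exact: IH.
Qed.

(** * Sorting a finite type by a function into an ordered field *)

Section SortBy.
Variables (R : realFieldType) (T : finType).
Implicit Types f g : T -> R.

Definition sort_by f := sort (relpre f <=%R) (enum T).

Lemma perm_sort_by f : perm_eq (sort_by f) (enum T).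
Proof. by rewrite perm_sort. Qed.

Lemma mem_sort_by f a : a \in sort_by f.
Proof. by rewrite mem_sort mem_enum. Qed.

Lemma uniq_sort_by f : uniq (sort_by f).
Proof. by rewrite sort_uniq enum_uniq. Qed.

Lemma size_sort_by f : size (sort_by f) = #|T|.
Proof. by rewrite size_sort cardE. Qed.

Lemma sort_by_sorted f : injective f -> sorted <%R (map f (sort_by f)).
Proof.
move=> fI; rewrite lt_sorted_uniq_le map_inj_uniq // uniq_sort_by /=.
by rewrite sorted_map; apply: sort_sorted => a b; apply: le_total.
Qed.

Lemma sort_by_unique f s : injective f -> perm_eq s (enum T) ->
  sorted <=%R (map f s) -> s = sort_by f.
Proof.
move=> fI ps ss; apply: (inj_map fI); apply: (sorted_eq le_trans le_anti) => //.
  by apply: sub_sorted (@ltW _ _) _ _; apply: sort_by_sorted.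
by apply/perm_map/(perm_trans ps); rewrite perm_sym perm_sort_by.
Qed.

Lemma sort_by_index f a b : injective f ->
  (f a < f b) = (index a (sort_by f) < index b (sort_by f))%N.
Proof.
move=> fI; have tr : transitive (relpre f <%R) by move=> ? ? ?; apply: lt_trans.
have ss : sorted (relpre f <%R) (sort_by f) by rewrite -sorted_map sort_by_sorted.
have lt c d : (index c (sort_by f) < index d (sort_by f))%N -> f c < f d.
  by move/(sorted_ltn_index tr ss); apply; rewrite mem_sort_by.
have [/lt -> //|/lt/ltW|E] := ltngtP (index a (sort_by f)) (index b (sort_by f)).
  by rewrite leNgt => /negbTE.
have -> : a = b by rewrite -(nth_index a (mem_sort_by f a)) E nth_index ?mem_sort_by.
by rewrite ltxx.
Qed.

Lemma eq_sort_by f g : injective f -> injective g ->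
  (forall a b, (f a < f b) = (g a < g b)) -> sort_by f = sort_by g.
Proof.
move=> fI gI E; apply: (sort_by_unique gI (perm_sort_by f)).
have := sort_by_sorted fI; rewrite !sorted_map; apply: sub_sorted => a b /=.
by rewrite E => /ltW.
Qed.

End SortBy.

(** * The word of alphas and betas of an odd labelling *)

Section Words.
Variables (R : realFieldType) (L : finType) (ng : L -> L).
Hypothesis ngK : involutive ng.
Implicit Types (y : L -> R) (a b : L * bool).

Definition lval y a : R := if a.2 then y a.1 + 1 / 2 else y a.1 - 1 / 2.

(** The opposite of the alpha value [y - 1 / 2] is the beta value of [- y], whence the flipped
    kind. *)
Definition lneg a := (ng a.1, ~~ a.2).

Definition word y := sort_by (lval y).

Definition half_pattern y := map snd (take #|L| (word y)).

Definition odd_labelling y := forall l, y (ng l) = - y l.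

Lemma lnegK : involutive lneg.
Proof. by case=> l t; rewrite /lneg /= ngK negbK. Qed.

Lemma lval_neg y a : odd_labelling y -> lval y (lneg a) = - lval y a.
Proof. by move=> oy; case: a => l []; rewrite /lval /= oy; lra. Qed.

Lemma size_word y : size (word y) = (#|L| + #|L|)%N.
Proof. by rewrite size_sort_by card_prod card_bool muln2 addnn. Qed.

Lemma sorted_lval_inj y w : perm_eq w (enum {: L * bool}) ->
  sorted <%R (map (lval y) w) -> injective (lval y).
Proof.
move=> pw; rewrite lt_sorted_uniq_le => /andP[uw _]; apply/injectiveP.
by rewrite /injectiveb /dinjectiveb -(perm_uniq (perm_map _ pw)).
Qed.

Lemma word_unique y w : perm_eq w (enum {: L * bool}) ->
  sorted <%R (map (lval y) w) -> w = word y.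
Proof.
move=> pw sw; apply: sort_by_unique (sorted_lval_inj pw sw) pw _.
exact: sub_sorted (@ltW _ _) _ sw.
Qed.

Lemma word_order y y' : injective (lval y) -> injective (lval y') ->
  word y = word y' ->
  forall a b, (lval y a < lval y b) = (lval y' a < lval y' b).
Proof. by move=> iy iy' E a b; rewrite !sort_by_index // -!/(word _) E. Qed.

Lemma labelling_inj y : injective (lval y) -> injective y.
Proof.
move=> iy l l' E.
by have [] : (l, true) = (l', true) by apply: iy; rewrite /lval /= E.
Qed.

Lemma lval_order y a b : a.2 = b.2 -> (lval y a < lval y b) = (y a.1 < y b.1).
Proof. by rewrite /lval => ->; case: b.2; rewrite ltrD2r. Qed.

Lemma filter_word y t (P : pred (L * bool)) :
  P =1 (fun a => a.2 == t) -> injective (lval y) ->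
  seq.filter P (word y) = [seq (l, t) | l <- sort_by y].
Proof.
move=> EP iy; apply: (inj_map iy); apply: (irr_sorted_eq lt_trans ltxx).
- rewrite sorted_map; apply: sorted_filter; first by move=> ? ? ?; apply: lt_trans.
  by rewrite -sorted_map; apply: sort_by_sorted.
- have iL := labelling_inj iy.
  rewrite -map_comp; have := sort_by_sorted iL; rewrite !sorted_map.
  by apply: sub_sorted => l l' /=; rewrite lval_order.
apply/eq_mem_map => -[l s]; rewrite mem_filter EP mem_sort_by andbT /=.
apply/eqP/mapP => [->|[k _ [_ ->]] //].
by exists l; rewrite // mem_sort_by.
Qed.

Lemma lval_neq0 y a : odd_labelling y -> injective (lval y) -> lval y a != 0.
Proof.
move=> oy iy; apply/eqP => E; have : a = lneg a by apply: iy; rewrite lval_neg // E oppr0.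
by case: a {E} => l []; rewrite /lneg.
Qed.

Lemma word_sym y : odd_labelling y -> injective (lval y) ->
  rev (map lneg (word y)) = word y.
Proof.
move=> oy iy; apply: word_unique.
  rewrite perm_rev; apply: uniq_perm; rewrite ?enum_uniq //.
    by rewrite map_inj_uniq ?uniq_sort_by //; apply: inv_inj lnegK.
  move=> a; rewrite mem_enum !inE; apply/mapP; exists (lneg a); rewrite ?mem_sort_by //.
  by rewrite lnegK.
rewrite map_rev rev_sorted -map_comp.
rewrite (@eq_map _ _ _ (-%R \o lval y)); last by move=> a; rewrite /= lval_neg.
rewrite map_comp sorted_map; move: (sort_by_sorted iy); apply: sub_sorted.
by move=> u v /=; rewrite ltrN2.
Qed.

Lemma filter_sorted_lt (T : Type) (f : T -> R) c (s : seq T) :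
  sorted <%R (map f s) ->
  [seq x <- s | f x < c] = take (count (fun x => f x < c) s) s.
Proof.
elim: s => //= x s IH sx; rewrite IH ?(path_sorted sx) //.
case: ifP => [//|/negbT]; rewrite -leNgt => cx.
rewrite (_ : count _ s = 0%N) ?take0 //.
apply/eqP; rewrite -leqn0 leqNgt -has_count.
apply/negP => /(has_nthP x)[i si]; rewrite ltNge => /negP; apply.
apply: (le_trans cx); apply: ltW; move: sx; rewrite (path_sortedE lt_trans) all_map.
by move=> /andP[/all_nthP H _]; apply: H.
Qed.

(** Negation exchanges negative and positive letters and none is zero, so exactly [#|L|] letters are
    negative. *)
Lemma take_word y : odd_labelling y -> injective (lval y) ->
  take #|L| (word y) = [seq a <- word y | lval y a < 0].
Proof.
move=> oy iy; rewrite filter_sorted_lt ?sort_by_sorted //; congr take.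
set P := fun a => lval y a < 0.
have E : count P (word y) = count (predC P) (word y).
  rewrite -{1}(word_sym oy iy) count_rev count_map; apply: eq_count => a.
  rewrite /= /P lval_neg // oppr_lt0 -leNgt le_eqVlt eq_sym.
  by rewrite (negbTE (lval_neq0 _ oy iy)).
by have := count_predC P (word y); rewrite -E size_word; lia.
Qed.

(** The alpha of a point lies one unit left of its beta, so in every prefix the betas inject into
    the alphas. *)
Lemma half_pattern_ballot y : injective (lval y) -> ballot 0 (half_pattern y).
Proof.
move=> iy; apply/ballotP => k; rewrite add0n /half_pattern -map_take !count_map.
set s := take k _.
have ms l : (l, true) \in s -> (l, false) \in s.
  rewrite /s -take_min !in_take ?mem_sort_by //; apply: ltn_trans.
  by rewrite -sort_by_index // /lval /=; lra.
rewrite -!size_filter -(size_map (fun a => (a.1, false)) [seq a <- s | _]).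
apply: uniq_leq_size.
  rewrite map_inj_in_uniq; first by rewrite filter_uniq // !take_uniq // uniq_sort_by.
  by move=> [l t] [l' t']; rewrite !mem_filter /= => /andP[-> _] /andP[-> _] [->].
move=> v /mapP[[l []]]; rewrite mem_filter => /andP[// _ ls] ->.
by rewrite mem_filter /= ms.
Qed.

Lemma size_half_pattern y : size (half_pattern y) = #|L|.
Proof. by rewrite size_map size_takel // size_word leq_addr. Qed.

(** By symmetry the second half of the pattern is the reversed complement of the first. Alphas, and
    likewise betas, come in the order of the points, so the word is the shuffle prescribed by the
    pattern. *)
Lemma word_from_half y y' : odd_labelling y -> odd_labelling y' ->
  injective (lval y) -> injective (lval y') ->
  (forall l l', (y l < y l') = (y' l < y' l')) ->
  half_pattern y = half_pattern y' -> word y = word y'.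
Proof.
move=> oy oy' iy iy' E Ep.
have Es : sort_by y = sort_by y'.
  by apply: eq_sort_by => //; apply: labelling_inj.
apply: (@eq_from_filter _ snd).
- have full z : odd_labelling z -> injective (lval z) ->
      map snd (word z) = half_pattern z ++ rev (map negb (half_pattern z)).
    move=> oz iz; rewrite -{1}(cat_take_drop #|L| (word z)) map_cat; congr cat.
    rewrite -{1}(word_sym oz iz) drop_rev size_map size_word addnK -map_take map_rev.
    by rewrite -!map_comp.
  by rewrite !full // Ep.
- by rewrite !(@filter_word _ true) ?Es // => a; case: a.2.
- by rewrite !(@filter_word _ false) ?Es // => a /=; case: a.2.
Qed.

Lemma perm_half_letters_lval y :
  perm_eq (half_letters (map y (enum L)))
    [seq (lval y a, a.2) | a <- enum {: L * bool} & lval y a <= 0].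
Proof.
rewrite -[X in perm_eq _ X](filter_map (fun a => (lval y a, a.2)) (fun v => v.1 <= 0)).
apply: perm_filter; rewrite -map_comp.
have -> : flatten [seq [:: (y l - 1 / 2, false); (y l + 1 / 2, true)] | l <- enum L]
    = [seq (lval y a, a.2) | a <- [seq (l, t) | l <- enum L, t <- [:: false; true]]].
  by rewrite map_allpairs.
apply: perm_map; apply: uniq_perm; rewrite ?enum_uniq //.
  by apply: allpairs_uniq; rewrite ?enum_uniq // => -[? ?] [? ?].
move=> [l t]; rewrite mem_enum !inE; apply/allpairsP; exists (l, t).
by rewrite mem_enum; case: t.
Qed.

(** A realization separates only the nonpositive letters; negation carries a coincidence of positive
    letters to them. *)
Lemma realizes_lval_inj y D : odd_labelling y ->
  realizes (map y (enum L)) D -> injective (lval y).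
Proof.
move=> oy [sD nD pD].
have {}pD := perm_trans pD (perm_half_letters_lval y).
have n0 a : lval y a <= 0 -> lval y a < 0.
  move=> a0; apply: (allP nD (lval y a, a.2)); rewrite (perm_mem pD); apply: map_f.
  by rewrite mem_filter a0 mem_enum.
have inj a b : lval y a < 0 -> lval y a = lval y b -> a = b.
  move=> a0 E.
  have mem c : lval y c < 0 -> c \in [seq a <- enum {: L * bool} | lval y a <= 0].
    by move=> /ltW c0; rewrite mem_filter c0 mem_enum.
  have : uniq (map fst D) by move: sD; rewrite lt_sorted_uniq_le => /andP[].
  rewrite (perm_uniq (perm_map _ pD)) -map_comp => u.
  move: (mem a a0); rewrite E in a0; move: (mem b a0) u E.
  elim: [seq _ <- _ | _] => //= c s IH.
  rewrite !inE => /orP[/eqP->|bs] /andP[cs us] E /orP[/eqP|] // => [as_|ac|as_].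
  - by case/negP: cs; rewrite /= -E; apply: (map_f (lval y)).
  - by case/negP: cs; rewrite -ac /= E; apply: (map_f (lval y)).
  - exact: IH.
move=> a b E; have [a0|a0] := ltP (lval y a) 0; first exact: inj.
have E' : lval y (lneg a) = lval y (lneg b) by rewrite !lval_neg // E.
apply: (inv_inj lnegK); apply: inj E' => //.
by apply: n0; rewrite lval_neg // oppr_le0.
Qed.

Lemma realizes_half y D : odd_labelling y -> realizes (map y (enum L)) D ->
  D = [seq (lval y a, a.2) | a <- take #|L| (word y)].
Proof.
move=> oy rD; have iy := realizes_lval_inj oy rD; case: rD => sD nD pD.
have {}pD := perm_trans pD (perm_half_letters_lval y).
apply: (@irr_sorted_eq _ (relpre fst <%R)).
- by move=> ? ? ?; apply: lt_trans.
- by move=> ?; apply: ltxx.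
- by rewrite -sorted_map.
- rewrite -sorted_map -map_comp map_take take_sorted //; exact: sort_by_sorted.
move=> v; rewrite (perm_mem pD) take_word //; apply/eq_mem_map => a.
rewrite mem_filter mem_enum [in RHS]mem_filter mem_sort_by !andbT le_eqVlt.
by rewrite (negbTE (lval_neq0 _ oy iy)).
Qed.

End Words.

(** * Signed orders *)

(** This reduces comparisons to signs and absolute values, the data kept in a code. *)
Lemma lt_by_norm (R : realDomainType) (a b : R) :
  (a < b) = if a < 0 then (0 <= b) || (`|b| < `|a|)
            else (0 <= b) && (`|a| < `|b|).
Proof.
have [a0|a0] := ltP a 0; have [b0|b0] := leP 0 b.
- by rewrite (lt_le_trans a0).
- by rewrite !ltr0_norm // ltrN2.
- by rewrite !ger0_norm.
- by apply/negbTE; rewrite -leNgt (le_trans (ltW b0)).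
Qed.

Lemma norm_lt_norm (R : realDomainType) (a b : R) :
  (`|a| < `|b|) = ((- b < a) && (a < b)) || ((b < a) && (a < - b)).
Proof.
have [b0|b0] := leP 0 b; rewrite ltr_norml.
  by rewrite (ger0_norm b0) orb_idr // => /andP[ba /(lt_trans ba)]; lra.
by rewrite (ltr0_norm b0) opprK orb_idl // => /andP[ba /(lt_trans ba)]; lra.
Qed.

Lemma perm_flatten_map (I T : eqType) (f g : I -> seq T) (s : seq I) :
  (forall i, perm_eq (f i) (g i)) ->
  perm_eq (flatten (map f s)) (flatten (map g s)).
Proof. by move=> fg; elim: s => //= i s IH; apply: perm_cat. Qed.

Section Codes.
Variables (R : realFieldType) (n : nat) (K : finType) (kn : K -> K) (kv : K -> R).
Hypothesis knK : involutive kn.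
Hypothesis kv_odd : forall k, kv (kn k) = - kv k.
Implicit Types X : 'I_n -> R.

(** [inl (i, false)] names [X i] and [inl (i, true)] its opposite; [K] names the fixed points, [0]
    for regions and [-1], [1] for sketches. *)
Definition label := ('I_n * bool + K)%type.

Definition label_neg (l : label) : label :=
  match l with inl (i, b) => inl (i, ~~ b) | inr k => inr (kn k) end.

Definition labelling X (l : label) : R :=
  match l with inl (i, b) => if b then - X i else X i | inr k => kv k end.

Lemma label_negK : involutive label_neg.
Proof. by case=> [[i b]|k] /=; rewrite ?negbK ?knK. Qed.

Lemma labelling_odd X : odd_labelling label_neg (labelling X).
Proof. by case=> [[i []]|k] /=; rewrite ?opprK. Qed.

Lemma card_label : #|{: label}| = (2 * n + #|K|)%N.
Proof. by rewrite card_sum card_prod card_ord card_bool mulnC. Qed.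

Definition generic X := injective (lval (labelling X)).

Definition neg_set X : {set 'I_n} := [set i | X i < 0].

Definition norm_order X : seq 'I_n := sort_by (fun i => `|X i|).

Lemma generic_norm X : generic X -> injective (fun i => `|X i|).
Proof.
move=> /labelling_inj gX i j /eqP; rewrite eqr_norm2 => /orP[] /eqP E.
  by have [] : inl (i, true) = inl (j, true) :> label by apply: gX; rewrite /= E.
by have [] : inl (i, true) = inl (j, false) :> label by apply: gX; rewrite /= E opprK.
Qed.

Lemma generic_neq0 X i : generic X -> X i != 0.
Proof.
move=> /labelling_inj gX; apply/eqP => E.
by have [] : inl (i, true) = inl (i, false) :> label by apply: gX; rewrite /= E oppr0.
Qed.

Lemma labelling_lt0 X i b : generic X ->
  (labelling X (inl (i, b)) < 0) = b (+) (i \in neg_set X).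
Proof.
move=> gX; rewrite inE; case: b => //=; rewrite oppr_lt0 ltNge le_eqVlt negb_or.
by rewrite (generic_neq0 i gX).
Qed.

Lemma norm_labelling X i b : `|labelling X (inl (i, b))| = `|X i|.
Proof. by case: b; rewrite //= normrN. Qed.

Lemma code_order X X' : generic X -> generic X' ->
  neg_set X = neg_set X' -> norm_order X = norm_order X' ->
  forall p q : 'I_n * bool,
    (labelling X (inl p) < labelling X (inl q)) =
    (labelling X' (inl p) < labelling X' (inl q)).
Proof.
move=> gX gX' EE EO [i b] [j c].
have No k l : (`|X k| < `|X l|) = (`|X' k| < `|X' l|).
  rewrite (sort_by_index _ _ (generic_norm gX)) (sort_by_index _ _ (generic_norm gX')).
  by rewrite -!/(norm_order _) EO.
rewrite (lt_by_norm (labelling X _)) (lt_by_norm (labelling X' _)).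
by rewrite !(leNgt 0) !labelling_lt0 // EE !norm_labelling !No.
Qed.

Lemma order_code X X' : generic X -> generic X' ->
  (forall l l', (labelling X l < labelling X l') = (labelling X' l < labelling X' l')) ->
  neg_set X = neg_set X' /\ norm_order X = norm_order X'.
Proof.
move=> gX gX' E; split.
  have lt0E (a : R) : (a < 0) = (a < - a) by apply/idP/idP; lra.
  by apply/setP => i; rewrite !inE !lt0E (E (inl (i, false)) (inl (i, true))).
apply: eq_sort_by; try exact: generic_norm; move=> i j; rewrite !norm_lt_norm.
have := E (inl (j, true)) (inl (i, false)); have := E (inl (i, false)) (inl (j, false)).
have := E (inl (j, false)) (inl (i, false)); have := E (inl (i, false)) (inl (j, true)).
by move=> /= -> -> -> ->.
Qed.

(** A realization depends only on the multiset of points, so each positive value may go to any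
    coordinate with any sign: [s] distributes the values in increasing order and [E] chooses the
    signs. *)
Lemma realize_code (E : {set 'I_n}) (s : seq 'I_n) Z D :
  perm_eq s (enum 'I_n) -> size Z = n -> all (fun z => 0 < z) Z ->
  realizes (sym_points Z ++ map kv (enum K)) D ->
  exists X, [/\ generic X, neg_set X = E, norm_order X = s &
    D = [seq (lval (labelling X) a, a.2) | a <- take #|{: label}| (word (labelling X))]].
Proof.
move=> ps sZ pZ rD.
have us : uniq s by rewrite (perm_uniq ps) enum_uniq.
have ms i : i \in s by rewrite (perm_mem ps) mem_enum.
have ss : size s = n by rewrite (perm_size ps) size_enum_ord.
pose Z' := sort <=%R Z.
have sZ' : size Z' = n by rewrite size_sort.
pose z i := nth 0 Z' (index i s).
have zZ : map z s = Z'.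
  apply: (@eq_from_nth _ 0); rewrite size_map ss ?sZ' // => k kn'.
  have i0 : 'I_n by apply: Ordinal kn'.
  by rewrite (nth_map i0) ?ss // /z index_uniq ?ss.
have z0 i : 0 < z i.
  have : z i \in Z by rewrite -(mem_sort <=%R) -/Z' -zZ map_f.
  exact: (allP pZ).
pose X i := if i \in E then - z i else z i.
have nX i : `|X i| = z i by rewrite /X; case: ifP => _; rewrite ?normrN gtr0_norm.
have pX : perm_eq (map (labelling X) (enum {: label})) (sym_points Z ++ map kv (enum K)).
  have : perm_eq (enum {: label})
      (map inl [seq (i, b) | i <- s, b <- [:: false; true]] ++ map inr (enum K)).
    apply: uniq_perm; rewrite ?enum_uniq //.
      rewrite cat_uniq !map_inj_uniq ?enum_uniq ?andbT; try by move=> ? ? [].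
      rewrite allpairs_uniq //=; last by move=> [? ?] [? ?].
      rewrite -enumT enum_uniq andbT; apply/hasPn => _ /mapP[k _ ->].
      by apply/mapP => -[].
    move=> l; rewrite mem_enum !inE mem_cat; case: l => [[i b]|k].
      rewrite map_f //; apply/allpairsP; exists (i, b); rewrite ms.
      by case: b.
    by rewrite orbC map_f ?mem_enum.
  move=> /(perm_map (labelling X))/perm_trans; apply.
  rewrite map_cat -[in X in _ ++ X]map_comp perm_cat2r.
  have -> : [seq labelling X l |
      l <- [seq inl p | p <- [seq (i, b) | i <- s, b <- [:: false; true]]]]
    = flatten [seq [:: X i; - X i] | i <- s].
    by rewrite -map_comp map_allpairs.
  have /perm_trans : perm_eq (flatten [seq [:: X i; - X i] | i <- s])
      (flatten [seq [:: - z i; z i] | i <- s]).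
    apply: perm_flatten_map => i; rewrite /X; case: ifP => _; rewrite ?opprK //.
    exact: (permEl (perm_catC [:: _] [:: _])).
  apply; rewrite (map_comp (fun v => [:: - v; v]) z) zZ.
  by apply/perm_flatten/perm_map; rewrite perm_sort.
have rX : realizes (map (labelling X) (enum {: label})) D.
  case: rD => sD nD pD; split=> //; apply: (perm_trans pD).
  by apply: perm_half_letters; rewrite perm_sym.
have gX : generic X := realizes_lval_inj label_negK (labelling_odd X) rX.
exists X; split => //.
- by apply/setP => i; rewrite inE /X; case: ifP => _; rewrite ?oppr_lt0 ?z0 // ltNge ltW ?z0.
- apply/esym/sort_by_unique => //; first exact: generic_norm.
  by rewrite (eq_map nX) zZ; apply: sort_sorted => ? ?; apply: le_total.
- exact: (realizes_half label_negK (labelling_odd X) rX).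
Qed.

End Codes.

Local Open Scope classical_set_scope.
Local Open Scope card_scope.
Local Open Scope ring_scope.

(** * Type BC sketches *)

(** A relation is more convenient than a function here, because sketches and regions receive their
    codes through a point that is not unique. *)
Lemma card_eq_code (U : Type) (A : set U) (T : finType) (P : {set T})
    (C : U -> T -> Prop) :
  (forall u, A u -> exists2 t, t \in P & C u t) ->
  (forall t, t \in P -> exists2 u, A u & C u t) ->
  (forall u u' t, A u -> A u' -> C u t -> C u' t -> u = u') ->
  (forall u t t', A u -> C u t -> C u t' -> t = t') ->
  A #= `I_#|P|.
Proof.
move=> tot sur inj fn.
(* On [A] the first hypothesis excludes the default value [0]. *)
pose f u : nat := if pselect (exists2 t, t \in P & C u t) is left h
  then index (projT1 (cid2 h)) (enum P) else 0%N.
have fE u t : A u -> t \in P -> C u t -> f u = index t (enum P).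
  move=> Au tP Cut; rewrite /f; case: pselect => [h|[]]; last by exists t.
  by case: cid2 => t' t'P Cut' /=; rewrite (fn _ _ _ Au Cut' Cut).
apply/card_set_bijP; exists f; split.
- move=> u Au; have [t tP Cut] := tot _ Au.
  by rewrite /= (fE _ t) // cardE index_mem mem_enum.
- move=> u u' /set_mem Au /set_mem Au'.
  have [t tP Cut] := tot _ Au; have [t' tP' Cut'] := tot _ Au'.
  rewrite (fE _ t) // (fE _ t') // => E; apply: (inj u u' t) => //.
  suff -> : t = t' by [].
  by rewrite -[t](nth_index t (s := enum P)) ?mem_enum // E nth_index ?mem_enum.
- move=> k /= kP; have t0 : T by move: kP; rewrite cardE; case: (enum P).
  have tP : nth t0 (enum P) k \in P by rewrite -mem_enum mem_nth -?cardE.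
  have [u Au Cu] := sur _ tP; exists u => //.
  by rewrite (fE _ _ Au tP Cu) index_uniq ?enum_uniq -?cardE.
Qed.

Definition codes n : {set {set 'I_n} * n.-tuple 'I_n * (2 * n + 1).-tuple bool} :=
  finset.setX (finset.setX finset.setT [set s : n.-tuple 'I_n | uniq s]%SET)
    [set p : (2 * n + 1).-tuple bool | ballot 0 p]%SET.

Lemma card_codes n : (1 <= n)%N ->
  #|codes n| = (2 ^ (n - 1) * n`! * 'C(2 * n + 2, n + 1))%N.
Proof.
move=> n1; rewrite /codes !cardsX -/(nballot _ _) nballot_odd.
rewrite -powersetT card_powerset cardsT card_ord.
have -> : #|[set s : n.-tuple 'I_n | uniq s]%SET| = n`!.
  have := card_uniq_tuples n (predT : pred 'I_n); rewrite card_ord ffactnn => <-.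
  by apply: eq_card => s; rewrite !inE all_predT.
(* Pascal's rule gives two equal terms; their factor 2 is taken from [2 ^ n], as [n] is positive. *)
have -> : 'C(2 * n + 2, n + 1) = (2 * 'C(2 * n + 1, n))%N.
  have -> : (2 * n + 2 = (2 * n + 1).+1)%N by lia.
  rewrite (addn1 n) binS -(@bin_sub (2 * n + 1) n); last lia.
  by rewrite (_ : 2 * n + 1 - n = n.+1)%N; lia.
by case: n n1 => // n _; rewrite subn1 /= expnS; lia.
Qed.

Lemma uniq_ord_perm n (s : seq 'I_n) : uniq s -> size s = n ->
  perm_eq s (enum 'I_n).
Proof.
move=> us ss; apply: uniq_perm; rewrite ?enum_uniq //.
have [||] // := uniq_min_size us (s2 := enum 'I_n); last by rewrite ss size_enum_ord.
by move=> i _; rewrite mem_enum.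
Qed.

Lemma map_eq_cat (S T : Type) (f : S -> T) s t1 t2 : map f s = t1 ++ t2 ->
  exists s1 s2, [/\ s = s1 ++ s2, map f s1 = t1 & map f s2 = t2].
Proof.
move=> E; exists (take (size t1) s), (drop (size t1) s).
by rewrite cat_take_drop map_take map_drop E take_size_cat ?drop_size_cat.
Qed.

Section Sketch.
Variables (R : realType) (n : nat).
Implicit Types X : 'I_n -> R.

Definition mark (b : bool) : R := if b then -1 else 1.

Notation lab := (label n bool).

Lemma mark_odd b : mark (~~ b) = - mark b.
Proof. by case: b; rewrite /mark //= opprK. Qed.

(** As [X i] is [x_i + 1/2], its alpha is [x_i] and its beta [x_i + 1]; the alpha of [- X i] is
    [- x_i - 1], hence the negated [a.2]. *)
Definition to_letter (a : lab * bool) : letter n :=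
  match a.1 with
  | inl (i, b) => if b then alpha_neg i (~~ a.2) else alpha_pos i a.2
  | inr true => if a.2 then alpha_m05 else alpha_m15
  | inr false => if a.2 then alpha_p15 else alpha_p05
  end.

Definition of_letter (l : letter n) : lab * bool :=
  match l with
  | alpha_pos i s => (inl (i, false), s)
  | alpha_neg i s => (inl (i, true), ~~ s)
  | alpha_m15 => (inr true, false)
  | alpha_m05 => (inr true, true)
  | alpha_p05 => (inr false, false)
  | alpha_p15 => (inr false, true)
  end.

Lemma to_letterK : cancel to_letter of_letter.
Proof. by case=> [[[i []]|[]] []]. Qed.

Lemma of_letterK : cancel of_letter to_letter.
Proof. by case=> //= i []. Qed.

Definition centered (x : 'rV[R]_n) : 'I_n -> R := fun i => x 0 i + 1 / 2.

Lemma letter_value_to_letter x a :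
  letter_value x (to_letter a) = lval (labelling mark (centered x)) a.
Proof.
by case: a => [[[i []]|[]] []]; rewrite /lval /= /mark /centered /=; lra.
Qed.

Lemma centered_row X : centered (\row_i (X i - 1 / 2)) = X.
Proof. by apply/funext => i; rewrite /centered mxE subrK. Qed.

Lemma pointed_symmetric_sketchE w : pointed_symmetric_sketch R w <->
  exists2 X, generic mark X & w = map to_letter (word (labelling mark X)).
Proof.
split=> [[pw [x sw]]|[X gX ->]].
  have pw' : perm_eq (map of_letter w) (enum {: lab * bool}).
    apply: uniq_perm; rewrite ?enum_uniq //.
      rewrite map_inj_uniq ?(perm_uniq pw) ?enum_uniq //.
      exact: can_inj of_letterK.
    move=> a; rewrite mem_enum !inE; apply/mapP; exists (to_letter a).
      by rewrite (perm_mem pw) mem_enum.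
    by rewrite to_letterK.
  have sw' : sorted <%R (map (lval (labelling mark (centered x))) (map of_letter w)).
    rewrite -map_comp; congr (sorted _ _): sw; apply: eq_map => l /=.
    by rewrite -letter_value_to_letter of_letterK.
  exists (centered x); first exact: sorted_lval_inj pw' sw'.
  by rewrite -(word_unique pw' sw') mapK //; apply: of_letterK.
split.
  apply: uniq_perm; rewrite ?enum_uniq //.
    rewrite map_inj_uniq ?uniq_sort_by //; exact: can_inj to_letterK.
  move=> l; rewrite mem_enum !inE; apply/mapP; exists (of_letter l).
    by rewrite mem_sort_by.
  by rewrite of_letterK.
exists (\row_i (X i - 1 / 2)); rewrite -map_comp.
have := sort_by_sorted gX; congr (sorted _ _); apply: eq_map => a /=.
by rewrite letter_value_to_letter centered_row.
Qed.

(** [a1] is the (n+1)-th alpha and [(inr true, true)], the beta of [-1], is the pointed beta. *)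
Definition marked X H1 a1 H2 :=
  [/\ take #|{: lab}| (word (labelling mark X)) = H1 ++ a1 :: (inr true, true) :: H2,
      ~~ a1.2 & count (fun a => ~~ a.2) H1 = n].

Lemma card_sketch_label : #|{: lab}| = (2 * n + 2)%N.
Proof. by rewrite card_label card_bool. Qed.

(** The two notions of alpha disagree only on [alpha_p05], the alpha of the point [1], written as a
    beta in the word. Its value is positive, so it is not in the first half. *)
Lemma is_ab_alpha_half X a : generic mark X ->
  a \in take #|{: lab}| (word (labelling mark X)) ->
  is_ab_alpha (ab_of_letter (to_letter a)) = ~~ a.2.
Proof.
move=> gX; rewrite (take_word (label_negK negbK) (labelling_odd mark_odd X)) //.
rewrite mem_filter => /andP[+ _].
by case: a => [[[i []]|[]] []] //=; rewrite /lval /mark /=; lra.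
Qed.

Lemma count_alpha_half X (s : seq (lab * bool)) : generic mark X ->
  {subset s <= take #|{: lab}| (word (labelling mark X))} ->
  count is_ab_alpha (map (@ab_of_letter n \o to_letter) s) = count (fun a => ~~ a.2) s.
Proof.
move=> gX sub; rewrite count_map; apply: eq_in_count => a /sub/is_ab_alpha_half E.
by rewrite /= E.
Qed.

Lemma type_BC_sketchE w : type_BC_sketch R w <->
  exists X, [/\ generic mark X, w = map to_letter (word (labelling mark X)) &
    exists H1 a1 H2, marked X H1 a1 H2].
Proof.
have abE X : pointed_ab_word (map to_letter (word (labelling mark X))) =
    map (@ab_of_letter n \o to_letter) (take #|{: lab}| (word (labelling mark X))).
  by rewrite /pointed_ab_word card_sketch_label -map_take -map_comp.
split.
  case=> /pointed_symmetric_sketchE[X gX ->] [u [v []]]; rewrite abE => + cu.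
  case/map_eq_cat => H1 [[|a1 [|a2 H2]] [EH Eu]] //= [E1 E2 Ev].
  exists X; split=> //; exists H1, a1, H2.
  have a2E : a2 = (inr true, true).
    by move: E2; case: a2 {EH} => [[[i []]|[]] []].
  split; first by rewrite EH a2E.
    by rewrite -(is_ab_alpha_half gX) ?E1 // EH mem_cat mem_head orbT.
  move: cu; rewrite -Eu (count_alpha_half gX) // => a aH.
  by rewrite EH mem_cat aH.
case=> X [gX -> [H1 [a1 [H2 [EH a1F cH]]]]]; split.
  by apply/pointed_symmetric_sketchE; exists X.
exists (map (@ab_of_letter n \o to_letter) H1), (map (@ab_of_letter n \o to_letter) H2).
rewrite abE EH map_cat /= (count_alpha_half gX) => [|a aH]; last by rewrite EH mem_cat aH.
split=> //; congr (_ ++ _ :: _).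
have : is_ab_alpha (ab_of_letter (to_letter a1)).
  by rewrite (is_ab_alpha_half gX) // EH mem_cat mem_head orbT.
by case: ab_of_letter.
Qed.


(** These are the betas of the points left of [-1]; their number tells where [-1] stands among the
    [X i] and their opposites. *)
Definition below_mark X : {set lab * bool} :=
  [set a | a.2 && (lval (labelling mark X) a < - (1 / 2))]%SET.

Lemma card_below_mark X H1 a1 H2 : generic mark X -> marked X H1 a1 H2 ->
  #|below_mark X| = count id (map snd H1).
Proof.
move=> gX [EH a1F _]; pose Q a := a.2 && (lval (labelling mark X) a < - (1 / 2)).
have -> : #|below_mark X| = count Q (word (labelling mark X)).
  rewrite (permP (perm_sort_by _)) cardE -size_filter /enum_mem -filter_predI.
  by congr size; apply: eq_filter => a; rewrite /= inE andbT.
have := sort_by_sorted gX; rewrite -/(word _).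
rewrite -(cat_take_drop #|{: lab}| (word (labelling mark X))) EH.
rewrite -catA (sorted_pairwise lt_trans) map_cat pairwise_cat /=.
case/and3P=> /allrelP H1lt _ /and3P[_ /allP mlt _].
have mE : mark true + 1 / 2 = - (1 / 2) by rewrite /mark; lra.
have Qa1 : Q a1 = false by rewrite /Q (negbTE a1F).
have Qm : Q (inr true, true) = false by rewrite /Q /lval /= mE ltxx.
rewrite count_cat /= Qa1 Qm !add0n.
rewrite [X in (_ + X)%N](_ : _ = 0%N) ?addn0.
  rewrite count_map; apply: eq_in_count => a aH; rewrite /Q /=.
  case: a.2 => //=.
  apply: lt_le_trans (H1lt _ (lval (labelling mark X) (inr true, true)) _ _) _.
  - exact: map_f.
  - by rewrite !inE eqxx orbT.
  - by rewrite /lval /= mE.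
apply/eqP; rewrite -leqn0 leqNgt -has_count; apply/hasPn => a aH.
rewrite /Q negb_and -leNgt; apply/orP; right; apply: ltW.
by have := mlt _ (map_f _ aH); rewrite /lval /= mE.
Qed.

(** Both sets are initial segments for the common order of the [X i] and their opposites. If [p]
    counted for [X] only, the set of [X'] would be properly contained in that of [X], against the
    equal cardinals. *)
Lemma below_mark_sub X X' : generic mark X -> generic mark X' ->
  neg_set X = neg_set X' -> norm_order X = norm_order X' ->
  #|below_mark X'| = #|below_mark X| ->
  forall p, labelling mark X (inl p) < -1 -> labelling mark X' (inl p) < -1.
Proof.
move=> gX gX' EE EO Ec p pX; rewrite ltNge; apply/negP => pX'.
have lv (Y : 'I_n -> R) l :
    (lval (labelling mark Y) (l, true) < - (1 / 2)) = (labelling mark Y l < -1).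
  by rewrite /lval /=; apply/idP/idP; lra.
have : (below_mark X' \proper below_mark X)%SET.
  apply/properP; split.
    apply/fintype.subsetP => -[[q|b] []] //; rewrite !inE /= ?lv //.
      move=> qX'; apply: lt_trans pX.
      by rewrite (code_order gX gX' EE EO) (lt_le_trans qX').
  exists (inl p, true); rewrite !inE /= !lv // -leNgt //.
by move/proper_card; rewrite Ec ltnn.
Qed.

(** Equal cardinals give [-1] the same place in both labellings, and negation does the same for
    [1]. *)
Lemma marked_order X X' : generic mark X -> generic mark X' ->
  neg_set X = neg_set X' -> norm_order X = norm_order X' ->
  #|below_mark X| = #|below_mark X'| ->
  forall l l', (labelling mark X l < labelling mark X l') =
               (labelling mark X' l < labelling mark X' l').
Proof.
move=> gX gX' EE EO Ec.
have lt p : (labelling mark X (inl p) < -1) = (labelling mark X' (inl p) < -1).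
  by apply/idP/idP; apply: below_mark_sub.
have neq (Y : 'I_n -> R) p b : generic mark Y ->
    labelling mark Y (inl p) != labelling mark Y (inr b).
  by move=> /labelling_inj gY; apply/eqP => /gY.
have gt p : (-1 < labelling mark X (inl p)) = (-1 < labelling mark X' (inl p)).
  by rewrite !lt_neqAle !(eq_sym (-1)) !(neq _ p true) // !leNgt lt.
have opp (Y : 'I_n -> R) i b :
    labelling mark Y (inl (i, b)) = - labelling mark Y (inl (i, ~~ b)).
  by case: b; rewrite /= ?opprK.
have lt1 p : (labelling mark X (inl p) < 1) = (labelling mark X' (inl p) < 1).
  by case: p => i b; rewrite (opp X) (opp X') !(ltrNl _ 1) gt.
have gt1 p : (1 < labelling mark X (inl p)) = (1 < labelling mark X' (inl p)).
  by case: p => i b; rewrite (opp X) (opp X') !(ltrNr 1) lt.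
by move=> [p|[]] [q|[]] //; apply: code_order.
Qed.

(** The third component omits the pointed beta, whose place after the (n+1)-th alpha is known. *)
Definition sketch_code w (t : {set 'I_n} * n.-tuple 'I_n * (2 * n + 1).-tuple bool) :=
  exists X H1 a1 H2,
    [/\ generic mark X, w = map to_letter (word (labelling mark X)),
        marked X H1 a1 H2 &
        [/\ t.1.1 = neg_set X, tval t.1.2 = norm_order X &
            tval t.2 = map snd H1 ++ false :: map snd H2]].

Lemma marked_half X H1 a1 H2 : marked X H1 a1 H2 ->
  half_pattern (labelling mark X) = map snd H1 ++ [:: false, true & map snd H2].
Proof.
by case=> EH /negbTE a1F _; rewrite /half_pattern EH map_cat /= a1F.
Qed.

Lemma marked_unmark_ballot X H1 a1 H2 : generic mark X -> marked X H1 a1 H2 ->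
  size (map snd H1 ++ false :: map snd H2) = (2 * n + 1)%N /\
  ballot 0 (map snd H1 ++ false :: map snd H2).
Proof.
move=> gX mX; have [_ _ cH] := mX.
apply: unmark_ballot; rewrite -?(marked_half mX).
- by rewrite size_half_pattern card_sketch_label.
- by rewrite count_map.
- exact: half_pattern_ballot.
Qed.

Lemma card_sketches : (1 <= n)%N ->
  [set w : seq (letter n) | type_BC_sketch R w]
    #= `I_(2 ^ (n - 1) * n`! * 'C(2 * n + 2, n + 1))%N.
Proof.
move=> n1; rewrite -card_codes //; apply: (@card_eq_code _ _ _ _ sketch_code).
- move=> w /type_BC_sketchE[X [gX Ew [H1 [a1 [H2 mX]]]]].
  have [sH bH] := marked_unmark_ballot gX mX.
  have sO : size (norm_order X) == n by rewrite size_sort_by card_ord.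
  exists (neg_set X, Tuple sO, Tuple (introT eqP sH)); last by exists X, H1, a1, H2.
  by rewrite !inE /= bH uniq_sort_by.
(* A ballot word of length [2 * n + 1] has more than [n] alphas, so it can be cut at the (n+1)-th,
   after which the pointed beta is put. *)
- move=> [[E s] p]; rewrite !inE /= => /andP[us bp].
  have ps : perm_eq s (enum 'I_n).
    exact: uniq_ord_perm us (size_tuple s).
  have [|u [v [Ep cu]]] := @split_false n p.
    exact: ballot_half bp (size_tuple p).
  have sp : size (u ++ false :: v) = (2 * n + 1)%N by rewrite -Ep size_tuple.
  rewrite Ep in bp.
  have [Z [D1 [D2 [sZ pZ rD D1u D2v]]]] := realize_sketch R sp cu bp.
  have Ek : [seq mark b | b <- enum {: bool}] = [:: -1; 1] by rewrite enumT unlock.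
  rewrite -Ek in rD.
  have [X [gX EX OX]] := realize_code negbK mark_odd E ps sZ pZ rD.
  case/esym/map_eq_cat => H1 [[|m H2] [EH EH1]] //= [Em1 Em2 EH2].
  (* By genericity the only letter at [- (1 / 2)] is the beta of [-1]. *)
  have Em : m = (inr true, true).
    by apply: gX; rewrite Em1 /lval /= /mark; lra.
  have : map snd H1 = rcons u false by rewrite -D1u -EH1 -map_comp.
  case/lastP: H1 EH EH1 => [|H1 a1]; first by case: (u).
  move=> EH _; rewrite map_rcons => /rcons_inj[EH1u a1F].
  have mX : marked X H1 a1 H2.
    split; first by rewrite EH Em cat_rcons.
      by rewrite a1F.
    by move: cu; rewrite -EH1u count_map.
  exists (map to_letter (word (labelling mark X))).
    by apply/type_BC_sketchE; exists X; split=> //; exists H1, a1, H2.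
  exists X, H1, a1, H2; split => //; split => //=.
  by rewrite Ep EH1u -D2v -EH2 -map_comp.
- move=> w w' t _ _ [X [H1 [a1 [H2 [gX -> mX [E1 E2 E3]]]]]].
  move=> [X' [H1' [a1' [H2' [gX' -> mX' [E1' E2' E3']]]]]].
  have [EH1 EH2] : map snd H1 = map snd H1' /\ map snd H2 = map snd H2'.
    apply: split_false_inj; first by rewrite -E3 -E3'.
    by have [_ _] := mX; have [_ _] := mX'; rewrite !count_map => -> ->.
  congr map; apply: (word_from_half (label_negK negbK)) => //.
  + exact: labelling_odd mark_odd X.
  + exact: labelling_odd mark_odd X'.
  (* The number of betas in [H1], read off the code, places [-1] among the other points. *)
  + apply: marked_order => //; rewrite -?E1 -?E2 //.
    by rewrite (card_below_mark gX mX) (card_below_mark gX' mX') EH1.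
  + by rewrite (marked_half mX) (marked_half mX') EH1 EH2.
- move=> w [[E s] p] [[E' s'] p'] _ [X [H1 [a1 [H2 [gX -> mX /= [E1 E2 E3]]]]]].
  move=> [X' [H1' [a1' [H2' [gX' Ew mX' /= [E1' E2' E3']]]]]].
  have {}Ew := inj_map (can_inj to_letterK) Ew.
  have Eo l l' : (labelling mark X l < labelling mark X l') =
                 (labelling mark X' l < labelling mark X' l').
    have := word_order gX gX' Ew (l, true) (l', true).
    by rewrite !lval_order.
  have [EE EO] := order_code gX gX' Eo.
  have EH : map snd H1 ++ [:: false, true & map snd H2] =
            map snd H1' ++ [:: false, true & map snd H2'].
    by rewrite -(marked_half mX) -(marked_half mX') /half_pattern Ew.
  have [EH1 [EH2]] : map snd H1 = map snd H1' /\ true :: map snd H2 = true :: map snd H2'.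
    apply: split_false_inj => //.
    by have [_ _] := mX; have [_ _] := mX'; rewrite !count_map => -> ->.
  congr (_, _, _); first by rewrite E1 E1'.
    by apply: val_inj; rewrite /= E2 E2'.
  by apply: val_inj; rewrite /= E3 E3' EH1 EH2.
Qed.

End Sketch.

(** * Regions *)

Section Regions.
Variables (R : realType) (n : nat).
Implicit Types x y : 'rV[R]_n.

Definition origin (_ : unit) : R := 0.

Notation lab := (label n unit).
Notation olval x := (lval (labelling origin (centered x))).
Notation U := (~` \bigcup_(H in arrangement_BC R n) H).

Lemma unitK : involutive (@id unit). Proof. by []. Qed.

Lemma origin_odd k : origin (id k) = - origin k.
Proof. by rewrite /origin oppr0. Qed.

(** Letters of [X i] and [- X i] meet when [x_i] is [-1], [-1/2] or [0]; letters of these points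
    meet those of [0] when [x_i] is [-3/2], [-1/2] or [1/2]. Two distinct indices give the
    hyperplanes in [x_i + x_j] and [x_i - x_j]. *)
Lemma complement_genericP x :
  U x <-> generic origin (centered x).
Proof.
split=> [Ux|gx].
  have h1 i c : c \in [:: - (3 / 2); - 1; - (1 / 2); 0; 1 / 2] -> x 0 i <> c.
    by move=> cc E; apply: Ux; exists [set x | x 0 i = c] => //; left; exists i, c.
  (* Hyperplanes are indexed by [i < j]. Exchanging the indices keeps the sum and negates the
     difference, whose list of constants is symmetric. *)
  have h2 i j c : i != j -> c \in [:: - 2; - 1; 0] -> x 0 i + x 0 j <> c.
    wlog : i j / (i < j)%N => [W ij cc|ij _ cc E].
      have [|/W|/val_inj E] := ltngtP i j; first by move=> /W; apply.
        by rewrite addrC; apply; rewrite // eq_sym.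
      by rewrite E eqxx in ij.
    apply: Ux; exists [set x | x 0 i + x 0 j = c] => //.
    by right; left; exists i, j, c.
  have h3 i j c : i != j -> c \in [:: - 1; 0; 1] -> x 0 i - x 0 j <> c.
    wlog : i j c / (i < j)%N => [W ij cc E|ij _ cc E].
      have [/W|/W W'|/val_inj E'] := ltngtP i j; first by move/(_ c); apply.
        apply: (W' (- c)); rewrite 1?eq_sym //; last by rewrite -E opprB.
        by move: cc; rewrite !inE => /or3P[]/eqP->; rewrite ?opprK ?oppr0 eqxx ?orbT.
      by rewrite E' eqxx in ij.
    apply: Ux; exists [set x | x 0 i - x 0 j = c] => //.
    by right; right; exists i, j, c.
  move=> [[[i b]|[]] s] [[[j c]|[]] t]; rewrite /lval /centered /origin /=.
  - have [<-|ij] := eqVneq i j.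
      have := h1 i (-1); have := h1 i (- (1 / 2)); have := h1 i 0.
      rewrite !inE !eqxx ?orbT => /(_ isT) n1 /(_ isT) n2 /(_ isT) n3.
      by case: b c s t => [] [] [] [] //= E; exfalso;
        first [apply: n1; lra|apply: n2; lra|apply: n3; lra|lra].
    have := h2 i j (-2) ij; have := h2 i j (-1) ij; have := h2 i j 0 ij.
    have := h3 i j 1 ij; have := h3 i j (-1) ij; have := h3 i j 0 ij.
    rewrite !inE !eqxx ?orbT => /(_ isT) n1 /(_ isT) n2 /(_ isT) n3.
    move=> /(_ isT) n4 /(_ isT) n5 /(_ isT) n6.
    by case: b c s t => [] [] [] [] //= E; exfalso;
      first [apply: n1; lra|apply: n2; lra|apply: n3; lra
            |apply: n4; lra|apply: n5; lra|apply: n6; lra].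
  - have := h1 i (- (3 / 2)); have := h1 i (- (1 / 2)); have := h1 i (1 / 2).
    rewrite !inE !eqxx ?orbT => /(_ isT) n1 /(_ isT) n2 /(_ isT) n3.
    by case: b s t => [] [] [] //= E; exfalso;
      first [apply: n1; lra|apply: n2; lra|apply: n3; lra].
  - have := h1 j (- (3 / 2)); have := h1 j (- (1 / 2)); have := h1 j (1 / 2).
    rewrite !inE !eqxx ?orbT => /(_ isT) n1 /(_ isT) n2 /(_ isT) n3.
    by case: c s t => [] [] [] //= E; exfalso;
      first [apply: n1; lra|apply: n2; lra|apply: n3; lra].
  - by case: s t => [] [] //= E; exfalso; lra.
(* Conversely, each hyperplane equation makes two explicit letters coincide. *)
have gN (a b : lab * bool) : a <> b -> olval x a <> olval x b by move=> ab /gx.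
move=> [_ [[i [c [cc ->]]]|[[i [j [c [ij cc ->]]]]|[i [j [c [ij cc ->]]]]]]] /= E.
- move: cc; rewrite !inE => /or3P[/eqP c0|/eqP c0|/or3P[/eqP c0|/eqP c0|/eqP c0]].
  + apply: (gN (inl (i, false), true) (inr tt, false)) => //.
    by rewrite /lval /= /centered /origin; lra.
  + apply: (gN (inl (i, false), true) (inl (i, true), false)) => //.
    by rewrite /lval /= /centered /origin; lra.
  + apply: (gN (inl (i, false), true) (inl (i, true), true)) => //.
    by rewrite /lval /= /centered /origin; lra.
  + apply: (gN (inl (i, false), false) (inl (i, true), true)) => //.
    by rewrite /lval /= /centered /origin; lra.
  + apply: (gN (inl (i, false), false) (inr tt, true)) => //.
    by rewrite /lval /= /centered /origin; lra.
- move: cc; rewrite !inE => /or3P[/eqP c0|/eqP c0|/eqP c0].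
  + apply: (gN (inl (i, false), true) (inl (j, true), false)) => //.
    by rewrite /lval /= /centered; lra.
  + apply: (gN (inl (i, false), true) (inl (j, true), true)) => //.
    by rewrite /lval /= /centered; lra.
  + apply: (gN (inl (i, false), false) (inl (j, true), true)) => //.
    by rewrite /lval /= /centered; lra.
- have nij : i != j by apply/eqP => e; rewrite e ltnn in ij.
  have lij s t : (inl (i, false), s) <> (inl (j, false), t) :> lab * bool.
    by case=> e _; rewrite e eqxx in nij.
  move: cc; rewrite !inE => /or3P[/eqP c0|/eqP c0|/eqP c0].
  + by apply: (gN _ _ (lij true false)); rewrite /lval /= /centered; lra.
  + by apply: (gN _ _ (lij true true)); rewrite /lval /= /centered; lra.
  + by apply: (gN _ _ (lij false true)); rewrite /lval /= /centered; lra.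
Qed.

Definition same_order x y := forall a b : lab * bool,
  (olval x a < olval x b) = (olval y a < olval y b).

Lemma lval_segment x y t a :
  olval (x + t *: (y - x)) a = (1 - t) * olval x a + t * olval y a.
Proof.
by case: a => [[[i []]|[]] []]; rewrite /lval /centered /origin /= ?mxE; ring.
Qed.

Lemma continuous_olval a : continuous (fun x => olval x a).
Proof.
have addc (f : 'rV[R]_n -> R) c : continuous f -> continuous (fun x => f x + c).
  move=> cf x; apply: (@continuousD _ _ _ f (fun=> c)); first exact: cf.
  exact: cst_continuous.
have oppc (f : 'rV[R]_n -> R) : continuous f -> continuous (fun x => - f x).
  by move=> cf x; apply: (@continuousN _ _ _ f); exact: cf.
have cX i : continuous (fun x : 'rV[R]_n => centered x i).
  by apply: addc; exact: coord_continuous.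
case: a => [[[i b]|[]] s]; rewrite /lval /=.
  by case: b s => [] []; apply: addc => //; apply: oppc.
by case: s; exact: cst_continuous.
Qed.

(** Convex combinations keep strict inequalities, so the segment between two points with the same
    order avoids the hyperplanes. Conversely, on a connected part of the complement a difference of
    two letters cannot change sign without vanishing. *)
Lemma connected_component_same_order x : U x ->
  connected_component U x = [set y | U y /\ same_order x y].
Proof.
move=> Ux; apply/seteqP; split=> y; last first.
  move=> [Uy xy]; pose g (t : R) := x + t *: (y - x).
  have cg : connected (g @` `[0, 1]).
    apply: connected_continuous_connected; first exact: segment_connected.
    apply: continuous_subspaceT => t; apply: cvgD; first exact: cvg_cst.
    by apply: cvgZr_tmp; exact: cvg_id.
  have gU : g @` `[0, 1] `<=` U.
    move=> v [t /=]; rewrite in_itv /= => /andP[t0 t1] <-.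
    apply/complement_genericP => a b; rewrite !lval_segment => E.
    apply/eqP/negPn/negP => ab.
    have gx := (complement_genericP x).1 Ux; have gy := (complement_genericP y).1 Uy.
    wlog : a b E ab / olval x a < olval x b => [W|lab_].
      have [/W|/W|/gx e] := ltgtP (olval x a) (olval x b); [exact| |].
        by apply; rewrite // eq_sym.
      by rewrite e eqxx in ab.
    have lab' : olval y a < olval y b by rewrite -xy.
    rewrite -subr_gt0 in lab_; rewrite -subr_gt0 in lab'.
    (* One of the weights [1 - t] and [t] is positive, which keeps the gap between the two letters
       positive. *)
    have [t2|t2] := leP t (1 / 2).
      have t1' : 0 < 1 - t by lra.
      have := mulr_gt0 t1' lab_; have := mulr_ge0 t0 (ltW lab'); nra.
    have t0' : 0 < t by lra.
    have t1' : 0 <= 1 - t by lra.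
    have := mulr_ge0 t1' (ltW lab_); have := mulr_gt0 t0' lab'; nra.
  apply: (connected_component_max _ gU cg).
    by exists 0; rewrite /= ?in_itv /= ?lexx ?ler01 // /g scale0r addr0.
  by exists 1; rewrite /= ?in_itv /= ?lexx ?ler01 // /g scale1r addrC subrK.
move=> [A [Ax AU cA] Ay]; split; first exact: AU.
have key a b z z' : A z -> A z' -> olval z a < olval z b -> olval z' a < olval z' b.
  move=> Az Az' lab_; rewrite ltNge; apply/negP => lba.
  pose f w := olval w b - olval w a.
  have cf : connected (f @` A).
    apply: connected_continuous_connected => //.
    apply: continuous_subspaceT => w.
    by apply: (@continuousB _ _ _ (fun w => olval w b) (fun w => olval w a));
      exact: continuous_olval.
  have [w Aw fw] : (f @` A) 0.
    apply: (connected_intervalP _).1 cf (f z') (f z) _ _ _ _.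
    - by exists z'.
    - by exists z.
    - by rewrite subr_le0 subr_ge0 lba ltW.
  have /complement_genericP gw := AU _ Aw.
  have e : b = a by apply: gw; apply/eqP; rewrite -subr_eq0; apply/eqP.
  by rewrite e ltxx in lab_.
by move=> a b; apply/idP/idP; apply: key.
Qed.

(** Any point of the region may serve, since all of them order the letters alike. *)
Definition region_code C (t : {set 'I_n} * n.-tuple 'I_n * (2 * n + 1).-tuple bool) :=
  exists x, [/\ U x, C = connected_component U x, t.1.1 = neg_set (centered x),
    tval t.1.2 = norm_order (centered x) &
    tval t.2 = half_pattern (labelling origin (centered x))].

Lemma card_unit_label : #|{: lab}| = (2 * n + 1)%N.
Proof. by rewrite card_label card_unit. Qed.

Lemma card_regions : (1 <= n)%N ->
  regions (arrangement_BC R n)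
    #= `I_(2 ^ (n - 1) * n`! * 'C(2 * n + 2, n + 1))%N.
Proof.
move=> n1; rewrite -card_codes //; apply: (@card_eq_code _ _ _ _ region_code).
- move=> _ [x Ux ->]; have gx := (complement_genericP x).1 Ux.
  have sO : size (norm_order (centered x)) == n by rewrite size_sort_by card_ord.
  have sH : size (half_pattern (labelling origin (centered x))) == (2 * n + 1)%N.
    by rewrite size_half_pattern card_unit_label.
  exists (neg_set (centered x), Tuple sO, Tuple sH); last by exists x.
  by rewrite !inE /= uniq_sort_by half_pattern_ballot.
- move=> [[E s] p]; rewrite !inE /= => /andP[us bp].
  have ps : perm_eq s (enum 'I_n) by exact: uniq_ord_perm us (size_tuple s).
  have [Z [D [sZ pZ rD Dp]]] := realize_region R (size_tuple p) bp.
  have Ek : [seq origin k | k <- enum {: unit}] = [:: 0] by rewrite enumT unlock.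
  rewrite -Ek in rD.
  have [X [gX EX OX DX]] := realize_code unitK origin_odd E ps sZ pZ rD.
  pose x : 'rV[R]_n := \row_i (X i - 1 / 2).
  have Ux : U x by apply/complement_genericP; rewrite centered_row.
  exists (connected_component U x); first by exists x.
  exists x; rewrite centered_row; split => //=.
  by rewrite -Dp DX -map_comp.
- move=> C C' t _ _ [x [Ux -> E1 E2 E3]] [x' [Ux' -> E1' E2' E3']].
  have gx := (complement_genericP x).1 Ux; have gx' := (complement_genericP x').1 Ux'.
  have EE : neg_set (centered x) = neg_set (centered x') by rewrite -E1.
  have EO : norm_order (centered x) = norm_order (centered x') by rewrite -E2.
  apply: same_connected_component; rewrite connected_component_same_order //.
  split=> //; apply: word_order => //.
  apply: (word_from_half (label_negK unitK)) => //.
  + exact: labelling_odd origin_odd _.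
  + exact: labelling_odd origin_odd _.
  (* The signs decide the comparisons with the point [0], which [code_order] does not cover. *)
  + have lt0 i b : (labelling origin (centered x) (inl (i, b)) < 0) =
                   (labelling origin (centered x') (inl (i, b)) < 0).
      by rewrite !labelling_lt0 // EE.
    have gt0 i b : (0 < labelling origin (centered x) (inl (i, b))) =
                   (0 < labelling origin (centered x') (inl (i, b))).
      have := lt0 i (~~ b); case: b => /=; first by rewrite !oppr_gt0.
      by rewrite !oppr_lt0.
    by move=> [[i b]|[]] [[j c]|[]] //; exact: code_order.
  + by rewrite -E3.
- move=> C [[E s] p] [[E' s'] p'] _ [x [Ux -> /= E1 E2 E3]] [x' [Ux' Ec /= E1' E2' E3']].
  have gx := (complement_genericP x).1 Ux; have gx' := (complement_genericP x').1 Ux'.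
  have : connected_component U x x' by rewrite Ec; exact: connected_component_refl.
  rewrite connected_component_same_order // => -[_ xx'].
  have [EE EO] : neg_set (centered x) = neg_set (centered x') /\
                 norm_order (centered x) = norm_order (centered x').
    apply: (order_code gx gx') => l l'.
    by have := xx' (l, true) (l', true); rewrite !lval_order.
  congr (_, _, _); first by rewrite E1 E1'.
    by apply: val_inj; rewrite /= E2 E2'.
  apply: val_inj; rewrite /= E3 E3' /half_pattern; congr (map _ (take _ _)).
  exact: eq_sort_by.
Qed.

End Regions.


Theorem theorem5p14 (R : realType) (n : nat) (n_ge1 : (1 <= n)%N) :
  [set w : seq (letter n) | type_BC_sketch R w]
    #= `I_(2 ^ (n - 1) * n`! * 'C(2 * n + 2, n + 1))%N /\
  regions (arrangement_BC R n)
    #= `I_(2 ^ (n - 1) * n`! * 'C(2 * n + 2, n + 1))%N.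
Proof. by split; [exact: card_sketches|exact: card_regions]. Qed.
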